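(* Let $m \geq 2$ be an integer and $q$ a prime power. Then $$\mathrm{gen}_{m,2}(q) = \frac{q^{4m-1}+q^{2m} -q^{3m}-q^{3m-1}}{q^2-1}.$$ The function $\mathrm{gen}_{m,2}(q)$ is strictly increasing in $m$ and in $q$. Furthermore, the following equation for the generating power series holds: $$\sum_{m=2}^{\infty} \mathrm{gen}_{m,2}(q)\, z^{m-2} = \frac{\mathrm{gen}_{2,2}(q)}{\left(1- z q^{2} \right) \left(1- z q^{3} \right) \left( 1 - z q^{4} \right)},$$ where $\mathrm{gen}_{2,2}(q) = q^4(q-1)$.
   Context: For a commutative ring $R$ with $1$, $M_n(R)$ is the $R$-algebra of $n\times n$ matrices over $R$, and $M_n(R)^k$ is the direct sum of $k$ copies of it with componentwise operations. A set $S$ generates an $R$-algebra $A$ if every element of $A$ is an $R$-linear combination of nonempty products of elements of $S$ (the identity element is not automatically included). An algebra ''has (admits) $m$ generators'' if it can be generated by $m$ elements. $\mathrm{gen}_{m,n}(R)$ is the integer such that the $R$-algebra $M_n(R)^{\mathrm{gen}_{m,n}(R)}$ admits $m$ generators, while $M_n(R)^{1+\mathrm{gen}_{m,n}(R)}$ needs at least $m+1$ generators; if every $R$-algebra $M_n(R)^k$ admits at most $m$ generators, then $\mathrm{gen}_{m,n}(R)=\infty$. For a prime power $q$, $\mathbb{F}_q$ is the field with $q$ elements and $\mathrm{gen}_{m,n}(q) = \mathrm{gen}_{m,n}(\mathbb{F}_q)$. The integer $m$ ranges over $m\ge 2$ and $q$ over prime powers. *)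

(* Defs.v *)
From HB Require Import structures.
From mathcomp Require Import all_boot all_order all_algebra.
From mathcomp Require Import mathcomp_extra boolp classical_sets constructive_ereal.
Set Implicit Arguments.
Unset Strict Implicit.
Unset Printing Implicit Defensive.
Import Order.TTheory GRing.Theory Num.Theory.
Local Open Scope ring_scope.

Notation matpow R n k := {ffun 'I_k -> 'M[R]_n}.

(* The words [cw.2] are nonempty, so that the identity is not available for
   free; the empty combination is allowed and yields 0. *)
Definition generates (R : comPzRingType) (n k : nat) (S : seq (matpow R n k)) :=
  forall a : matpow R n k, exists2 l : seq (R * seq (matpow R n k)),
    (forall cw, cw \in l -> cw.2 != [::] /\ {subset cw.2 <= S}) &
    a = \sum_(cw <- l) cw.1 *: \prod_(x <- cw.2) x.

Definition admits (R : comPzRingType) (n k m : nat) :=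
  exists S : m.-tuple (matpow R n k), generates S.

Definition gen_spec (m n : nat) (R : comPzRingType) (g : \bar rat) :=
  (exists k : nat, [/\ g = (k%:R)%:E, admits R n k m
     & forall m', admits R n k.+1 m' -> (m.+1 <= m')%N]) \/
  (g = +oo%E /\ forall k, exists2 m', (m' <= m)%N & admits R n k m').

(* [gen_spec m n R] holds for exactly one value: see [gen_specP] and
   [gen_spec_uniq]; the default value of [xget] is thus never used. *)
Definition gen (m n : nat) (R : comPzRingType) : \bar rat :=
  xget +oo%E [set g | gen_spec m n R g]%classic.

Lemma admitsS (R : comPzRingType) (n k m : nat) :
  admits R n k.+1 m -> admits R n k m.
Proof.
pose phi (f : matpow R n k.+1) : matpow R n k :=
  [ffun i => f (widen_ord (leqnSn k) i)].
have phi0 : phi 0 = 0 by apply/ffunP => i; rewrite !ffunE.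
have phi1 : phi 1 = 1 by apply/ffunP => i; rewrite !ffunE.
have phiD : {morph phi : x y / x + y} by move=> x y; apply/ffunP => i; rewrite !ffunE.
have phiM : {morph phi : x y / x * y} by move=> x y; apply/ffunP => i; rewrite !ffunE.
have phiZ c : {morph phi : x / c *: x} by move=> x; apply/ffunP => i; rewrite !ffunE.
case=> S genS; exists [tuple of map phi S] => a.
pose b : matpow R n k.+1 := [ffun i => oapp a 0 (insub (val i))].
have -> : a = phi b.
  apply/ffunP => i; rewrite !ffunE /= insubT //= => lt_ik.
  by congr (a _); apply: val_inj.
have [l lS ->] := genS b.
exists [seq (cw.1, map phi cw.2) | cw <- l].
  move=> _ /mapP[cw /lS[nz sub] ->] /=; split; first by case: cw.2 nz.
  by move=> _ /mapP[x /sub xS ->]; apply: map_f.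
rewrite (big_morph phi phiD phi0) big_map; apply: eq_bigr => cw _ /=.
by rewrite phiZ (big_morph phi phiM phi1) big_map.
Qed.

Lemma admits_le (R : comPzRingType) (n m k k' : nat) :
  (k <= k')%N -> admits R n k' m -> admits R n k m.
Proof. by move/subnK <-; elim: (k' - k)%N => // d IH /admitsS. Qed.

Lemma admits_leq (R : comPzRingType) (n k m m' : nat) :
  (m <= m')%N -> admits R n k m -> admits R n k m'.
Proof.
move=> /subnKC <- [S genS]; exists [tuple of S ++ nseq (m' - m) 0] => a.
have [l lS ->] := genS a; exists l => // cw /lS[nz sub]; split=> // x /sub xS.
by rewrite mem_cat xS.
Qed.

Lemma gen_spec_uniq (m n : nat) (R : comPzRingType) (g g' : \bar rat) :
  gen_spec m n R g -> gen_spec m n R g' -> g = g'.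
Proof.
have ninf k : (forall m', admits R n k.+1 m' -> (m.+1 <= m')%N) ->
    ~ forall k, exists2 m', (m' <= m)%N & admits R n k m'.
  by move=> kP /(_ k.+1)[m' lem' /kP]; rewrite ltnNge lem'.
have le k k' : admits R n k m ->
    (forall m', admits R n k'.+1 m' -> (m.+1 <= m')%N) -> (k <= k')%N.
  by move=> kP k'P; rewrite leqNgt; apply/negP => /admits_le/(_ kP)/k'P; rewrite ltnn.
case=> [[k [-> kP kN]]|[-> gP]] [[k' [-> k'P k'N]]|[-> g'P]] //.
- by congr (_%:R%:E); apply/eqP; rewrite eqn_leq !le.
- by case: (ninf _ kN g'P).
- by case: (ninf _ k'N gP).
Qed.

Lemma gen_specP (m n : nat) (R : comPzRingType) : gen_spec m n R (gen m n R).
Proof.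
suff [g gP] : exists g, gen_spec m n R g by exact: (xgetPex +oo%E (ex_intro _ g gP)).
have [allP|/existsNP exN] := pselect (forall k, admits R n k m).
  by exists +oo%E; right; split=> // k; exists m.
have {}exN : exists k, ~~ `[< admits R n k m >].
  by case: exN => k Nk; exists k; apply/asboolPn.
case: (ex_minnP exN) => -[|k] /asboolPn Nk min_k.
  case: Nk; exists [tuple of nseq m 0] => a; exists [::]; rewrite // big_nil.
  by apply/ffunP => i; case: (notF (ltn_ord i)).
exists (k%:R%:E); left; exists k; split=> //.
  by apply: contrapT => /asboolPn /min_k; rewrite ltnn.
by move=> m' m'P; rewrite ltnNge; apply/negP => /admits_leq/(_ m'P).
Qed.

(* The formal power series \sum_i f_i z^i is encoded by its coefficient
   function f : nat -> K; a polynomial p in z is the series with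
   coefficients p`_i. *)
Section FormalPowerSeries.
Variable K : fieldType.
Implicit Types f g : nat -> K.

Definition fps_poly (p : {poly K}) : nat -> K := fun i => p`_i.

Definition fps_mul f g : nat -> K :=
  fun n => \sum_(i < n.+1) f i * g (n - i)%N.

(* The first n coefficients of 1 / f, obtained by solving f * h = 1 degree
   by degree. *)
Fixpoint fps_inv_seq f (n : nat) : seq K :=
  if n is n'.+1 then
    let s := fps_inv_seq f n' in
    rcons s ((f 0)^-1 * ((n' == 0)%:R - \sum_(i < n') f (n' - i)%N * s`_i))
  else [::].

Definition fps_inv f : nat -> K := fun n => (fps_inv_seq f n.+1)`_n.

Definition fps_div f g : nat -> K := fps_mul f (fps_inv g).

Lemma size_fps_inv_seq f n : size (fps_inv_seq f n) = n.
Proof. by elim: n => //= n IH; rewrite size_rcons IH. Qed.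

Lemma nth_fps_inv_seq f n i : (i < n)%N -> (fps_inv_seq f n)`_i = fps_inv f i.
Proof.
elim: n => // n IH; rewrite ltnS leq_eqVlt => /predU1P[->//|lin].
by rewrite -(IH lin) /= nth_rcons size_fps_inv_seq lin.
Qed.

Lemma fps_mulV f : f 0 != 0 ->
  fps_mul (fps_inv f) f =1 (fun n => (n == 0)%:R).
Proof.
move=> f0 n; rewrite /fps_mul big_ord_recr /= subnn {2}/fps_inv /=.
rewrite nth_rcons size_fps_inv_seq ltnn eqxx mulrAC mulVf // mul1r.
rewrite addrC (eq_bigr (fun i : 'I_n => fps_inv f i * f (n - i)%N)) ?subrK // => i _.
by rewrite nth_fps_inv_seq // mulrC.
Qed.

End FormalPowerSeries.

(* Main.v *)
Require Import Defs.
From mathcomp Require Import all_boot all_order all_algebra all_fingroup.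
From mathcomp Require Import boolp constructive_ereal ring.
Set Implicit Arguments.
Unset Strict Implicit.
Unset Printing Implicit Defensive.
Import Order.TTheory GRing.Theory Num.Theory.
Local Open Scope ring_scope.

(** For any finite field F, a subset of the algebra M_n(F)^k is best studied
through its k coordinates. If m elements generate M_n(F)^k, then each coordinate
is a generating m-tuple of M_n(F), and two distinct coordinates s, t are never
conjugate: the relation s_j g = g t_j would pass to the whole algebra, which
contains elements with arbitrary pairs of coordinates. Conversely these two
conditions suffice ([generating_powP]). Fix two coordinates of the subalgebra
that is generated. If some element vanishes at the second one but not at the
first, simplicity of M_n(F) provides one that is 1 at the first. If there is
none, the first coordinate is a function of the second, and lifting the matrix
units of the second coordinate gives, as in the proof of the Skolem-Noether
theorem, an intertwiner of the two tuples, which is invertible by Schur's lemma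
([intertwiner_unit]). Products of the separating elements are the coordinate
idempotents.

Hence the largest k for which M_n(F)^k admits m generators is the number of
GL_n(F)-orbits on the generating m-tuples of M_n(F) ([admitsP],
[gen_gen_orbits]). The stabilizer of a generating tuple is the group of scalars,
so all these orbits have the same size ([card_gen_tuples]), and only the number
of generating tuples is missing.

For n = 2, a tuple is given by four vectors of F^m: the lower left entries c,
the lower right entries d, the differences e of the diagonal entries, and the
upper right entries b. The tuple fails to generate exactly when it has a common
eigenvector or lies in F + Fz for some matrix z. The line spanned by (1, 0) is
invariant when c = 0, the line spanned by (x, 1) when b = x^2 c - x e, and the
tuple lies in such a commutative algebra, for c nonzero, when e and b are
multiples of c ([gen_tuple_of]). When e is a multiple of c, the vectors
x^2 c - x e are multiples of c as well. So, whatever the position of e, once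
c <> 0 and e are fixed, exactly q vectors b are excluded. With Q = q^m the
number of generating tuples is therefore (Q - 1) Q Q (Q - q)
([card_gen_tuples2]), and division by the size of PGL_2(F) gives

  gen_{m,2}(q) = Q^2 (Q - 1) (Q - q) / (q (q^2 - 1))   ([gen2E]).

This is the stated closed form. It increases with Q, hence with m; in terms of
q it is a product of increasing functions ([gen2_value_ltq]); and it is a
combination of the powers q^(4m), q^(3m), q^(2m), hence satisfies the linear
recurrence encoded by the denominator of the generating series. *)

(** * Generating families of algebras *)

(** The scaling operation is a parameter so that the definition covers M_n(R)^k
with n = 0 or k = 0 too, where 1 = 0: algebra structures are nontrivial rings. *)
Definition subalgebra (R A : pzRingType) (sc : R -> A -> A) (P : A -> Prop) :=
  [/\ P 0, forall x y, P x -> P y -> P (x + y), forall c x, P x -> P (sc c x)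
    & forall x y, P x -> P y -> P (x * y)].

(** Generation is phrased through subalgebras rather than words: a property that
defines a subalgebra then passes from the generators to every element. *)
Definition generating (R A : pzRingType) (sc : R -> A -> A) (I : Type)
    (s : I -> A) :=
  forall P, subalgebra sc P -> (forall i, P (s i)) -> forall a, P a.

Lemma subalgebra_sum (R A : pzRingType) (sc : R -> A -> A) P (I : Type)
    (r : seq I) (Q : pred I) (f : I -> A) :
  subalgebra sc P -> (forall i, Q i -> P (f i)) -> P (\sum_(i <- r | Q i) f i).
Proof. by case=> P0 PD _ _ Pf; apply: big_ind. Qed.

Lemma generates_generating (R : comPzRingType) (n k m : nat)
    (S : m.-tuple (matpow R n k)) :
  generates S <-> @generating R (matpow R n k) *:%R _ (tnth S).
Proof.
split=> [genS P Palg PS a|genS a].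
  have [P0 PD PZ PM] := Palg.
  have [l lS ->] := genS a.
  rewrite big_seq; apply: (subalgebra_sum _ Palg) => -[c w] /lS[/= nz sub].
  apply: PZ; elim: w nz sub => // x w IHw _ sub; rewrite big_cons.
  have Px : P x by have /tnthP[i ->] := sub x (mem_head _ _).
  case: w IHw sub => [_ _|y w IHw sub]; first by rewrite big_nil mulr1.
  by apply: PM => //; apply: IHw => // z zw; apply: sub; rewrite inE zw orbT.
pose P (x : matpow R n k) := exists2 l : seq (R * seq (matpow R n k)),
  (forall cw, cw \in l -> cw.2 != [::] /\ {subset cw.2 <= S}) &
  x = \sum_(cw <- l) cw.1 *: \prod_(y <- cw.2) y.
apply: (genS P) => [|i]; last first.
  exists [:: (1, [:: tnth S i])]; last by rewrite !big_seq1 scale1r.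
  move=> cw; rewrite inE => /eqP->; split=> // x; rewrite inE => /eqP->.
  exact: mem_tnth.
split=> [|_ _ [l1 l1S ->] [l2 l2S ->]|c _ [l lS ->]|_ _ [l1 l1S ->] [l2 l2S ->]].
- by exists [::]; rewrite ?big_nil.
- exists (l1 ++ l2); last by rewrite big_cat.
  by move=> cw; rewrite mem_cat => /orP[/l1S|/l2S].
- exists [seq (c * cw.1, cw.2) | cw <- l]; first by move=> _ /mapP[cw /lS ? ->].
  by rewrite big_map scaler_sumr; apply: eq_bigr => cw _; rewrite scalerA.
exists [seq (cw.1 * cw'.1, cw.2 ++ cw'.2) | cw <- l1, cw' <- l2].
  move=> _ /allpairsP[[cw cw'] /= [/l1S[nz sub] /l2S[_ sub'] ->]] /=.
  split=> [|x]; first by case: cw.2 nz.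
  by rewrite mem_cat => /orP[/sub|/sub'].
rewrite big_allpairs_dep mulr_suml; apply: eq_bigr => cw _.
rewrite mulr_sumr; apply: eq_bigr => cw' _ /=.
rewrite big_cat /=; apply/ffunP => i; rewrite !ffunE.
by rewrite -[LHS]/(_ *m _) -scalemxAl -scalemxAr scalerA.
Qed.

(** * Subalgebras of powers of a matrix algebra *)

(** Simplicity of M_n(F): the two-sided ideal generated by a nonzero matrix
contains 1. *)
Lemma mx_simple (F : fieldType) (n : nat) (a : 'M[F]_n) p q : a p q != 0 ->
  \sum_r (a p q)^-1 *: ((delta_mx r p : 'M_n) *m a *m (delta_mx q r : 'M_n)) = 1.
Proof.
move=> a_nz; apply/matrixP => i j; rewrite summxE mxE.
rewrite (bigD1 j) //= big1 => [|r rj].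
  rewrite mxE -mulmxA mxE (bigD1 p) //= big1 => [|k kp]; last first.
    by rewrite mxE (negbTE kp) andbF mul0r.
  rewrite !mxE (bigD1 q) //= big1 => [|k kq]; last first.
    by rewrite !mxE (negbTE kq) mulr0.
  by rewrite !mxE !eqxx !andbT !addr0 mulr1; case: eqP;
    rewrite ?mul1r ?mulVf ?mul0r ?mulr0.
rewrite mxE mxE big1 ?mulr0 // => k _.
by rewrite mxE [delta_mx q r _ _]mxE (eq_sym j) (negbTE rj) andbF mulr0.
Qed.

Lemma mulmx_delta (R : comPzRingType) (n : nat) (a : 'M[R]_n) p q :
  a *m delta_mx p q = \sum_r a r p *: (delta_mx r q : 'M_n).
Proof.
apply/matrixP => i j; rewrite mxE summxE (bigD1 p) //= big1 ?addr0; last first.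
  by move=> r rp; rewrite mxE (negbTE rp) mulr0.
rewrite (bigD1 i) //= big1 ?addr0 ?mxE ?eqxx // => r ri.
by rewrite !mxE (eq_sym i) (negbTE ri) mulr0.
Qed.

Section Pow.
Variables (F : fieldType) (n k : nat) (I : Type).
Implicit Types (s : I -> matpow F n k) (P : matpow F n k -> Prop).

Local Notation generating_pow := (@generating F (matpow F n k) *:%R I).
Local Notation generating_mx := (@generating F 'M[F]_n *:%R I).
Local Notation subalgebra_pow := (@subalgebra F (matpow F n k) *:%R).

Lemma generating_coord s i :
  generating_pow s -> generating_mx (fun j => s j i).
Proof.
move=> gen_s P [P0 PD PZ PM] Ps a.
suff /(_ [ffun=> a]) : forall x : matpow F n k, P (x i) by rewrite ffunE.
apply: gen_s => //; split=> [|x y|c x|x y]; rewrite !ffunE //.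
- exact: PD.
- exact: PZ.
- exact: PM.
Qed.

(** The relation x_i1 g = g x_i2 defines a subalgebra, hence holds for all x as
soon as it holds for the generators; take for x the idempotent of i1. *)
Lemma generating_no_intertwiner s i1 i2 (g : 'M_n) :
    generating_pow s -> i1 != i2 ->
  (forall j, s j i1 *m g = g *m s j i2) -> g = 0.
Proof.
move=> gen_s i12 sg.
have /(_ [ffun i => (i == i1)%:R]) : forall x : matpow F n k, x i1 *m g = g *m x i2.
  apply: gen_s => //; split=> [|x y xg yg|c x xg|x y xg yg]; rewrite !ffunE.
  - by rewrite mul0mx mulmx0.
  - by rewrite mulmxDl mulmxDr xg yg.
  - by rewrite -scalemxAl -scalemxAr xg.
  - by rewrite -mulmxA yg mulmxA xg -mulmxA.
by rewrite !ffunE eqxx eq_sym (negbTE i12) mul1mx mulmx0.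
Qed.

Section Converse.
Variable s : I -> matpow F n k.
Hypothesis gen_s : forall i, generating_mx (fun j => s j i).
Hypothesis s_nonconj : forall i1 i2 (g : 'M_n), i1 != i2 ->
  (forall j, s j i1 *m g = g *m s j i2) -> g = 0.
Variable P : matpow F n k -> Prop.
Hypothesis subP : subalgebra_pow P.
Hypothesis Ps : forall j, P (s j).

Lemma coord_surj i u : exists2 x, P x & x i = u.
Proof.
have [P0 PD PZ PM] := subP.
apply: (@gen_s i (fun v => exists2 x, P x & x i = v)) => [|j]; last by exists (s j).
split=> [|_ _ [x Px <-] [y Py <-]|c _ [x Px <-]|_ _ [x Px <-] [y Py <-]].
- by exists 0; rewrite ?ffunE.
- by exists (x + y); rewrite ?ffunE //; apply: PD.
- by exists (c *: x); rewrite ?ffunE //; apply: PZ.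
- by exists (x * y); rewrite ?ffunE //; apply: PM.
Qed.

(** The i1-th coordinates of the elements that vanish at i2 form a two-sided ideal
of M_n(F), since P surjects onto the coordinate i1; then use [mx_simple]. *)
Lemma separate_from i1 i2 z : P z -> z i2 = 0 -> z i1 != 0 ->
  exists2 x, P x & x i1 = 1 /\ x i2 = 0.
Proof.
have [P0 PD PZ PM] := subP.
move=> Pz z2 /matrix0Pn[p [q znz]].
pose lft u := sval (cid2 (coord_surj i1 u)).
have Plft u : P (lft u) by rewrite /lft; case: cid2.
have lftE u : lft u i1 = u by rewrite /lft; case: cid2.
exists (\sum_r (z i1 p q)^-1 *: (lft (delta_mx r p) * z * lft (delta_mx q r))).
  by apply: (subalgebra_sum _ subP) => r _; apply/PZ/PM/Plft/PM.
rewrite !sum_ffunE; split.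
  rewrite -[RHS](mx_simple znz); apply: eq_bigr => r _.
  by rewrite !ffunE !lftE.
by rewrite big1 // => r _; rewrite !ffunE z2 mulr0 mul0r scaler0.
Qed.

(** Otherwise an element of P that vanishes at i2 also vanishes at i1. Lift the
matrix units at i2 to elements X p q of P: left multiplication by x in P combines the
X p q i1, for fixed q, with the coefficients of x i2. So, for fixed q and a, the
matrix whose p-th column is the a-th column of X p q i1 is an intertwiner, and is
zero by hypothesis. All X p q then vanish at i1, and subtracting from an x with
x i1 = 1 its expansion at i2 in matrix units separates the two coordinates after
all. *)
Lemma separate i1 i2 : i1 != i2 -> exists2 x, P x & x i1 = 1 /\ x i2 = 0.
Proof.
have [P0 PD PZ PM] := subP.
move=> i12.
have [[z [Pz z2 z1]]|noz] := pselect (exists z, [/\ P z, z i2 = 0 & z i1 != 0]).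
  exact: separate_from z2 z1.
have {}noz z : P z -> z i2 = 0 -> z i1 = 0.
  by move=> Pz z2; apply/eqP; apply: contra_notT noz => z1; exists z.
pose X p q := sval (cid2 (coord_surj i2 (delta_mx p q))).
have PX p q : P (X p q) by rewrite /X; case: cid2.
have XE p q : X p q i2 = delta_mx p q by rewrite /X; case: cid2.
have PN x : P x -> P (- x) by rewrite -scaleN1r; apply: PZ.
have Y0 p q : X p q i1 = 0.
  suff gE a : \matrix_(i, r) X r q i1 i a = 0.
    by apply/matrixP => i a; have /matrixP/(_ i p) := gE a; rewrite !mxE.
  apply: (s_nonconj i12) => j; apply/matrixP => i {}p.
  pose w := s j * X p q - \sum_r s j i2 r p *: X r q.
  have Pw : P w.
    by apply/PD/PN/(subalgebra_sum _ subP) => [|r _]; [apply: PM | apply: PZ].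
  have w2 : w i2 = 0.
    rewrite !ffunE sum_ffunE XE -[_ * _]/(_ *m _) mulmx_delta.
    by rewrite -sumrB big1 // => r _; rewrite ffunE XE subrr.
  have /matrixP/(_ i a)/eqP := noz w Pw w2.
  rewrite !ffunE !mxE sum_ffunE summxE subr_eq0 => /eqP wia.
  rewrite (eq_bigr (fun r => s j i1 i r * X p q i1 r a)) => [|r _]; last by rewrite mxE.
  rewrite wia; apply: eq_bigr => r _.
  by rewrite ffunE !mxE mulrC.
have [x Px x1] := coord_surj i1 1.
exists (x - \sum_p \sum_q x i2 p q *: X p q).
  apply/PD/PN/(subalgebra_sum _ subP) => // p _.
  by apply: (subalgebra_sum _ subP) => q _; apply: PZ.
rewrite !ffunE !sum_ffunE x1; split.
  rewrite big1 ?subr0 // => p _; rewrite sum_ffunE big1 // => q _.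
  by rewrite ffunE Y0 scaler0.
apply/eqP; rewrite subr_eq0 {1}[x i2]matrix_sum_delta.
apply/eqP/eq_bigr => p _; rewrite sum_ffunE; apply: eq_bigr => q _.
by rewrite ffunE XE.
Qed.

Lemma coordinate_idempotent i : P [ffun j => (j == i)%:R].
Proof.
have [P0 PD PZ PM] := subP.
suff [x Px [xi xj]] : exists2 x, P x &
    x i = 1 /\ {in enum 'I_k, forall j, j != i -> x j = 0}.
  suff -> : [ffun j => (j == i)%:R] = x by [].
  apply/ffunP => j; rewrite ffunE; case: eqP => [->//|/eqP ji].
  by rewrite xj // mem_enum.
elim: (enum _) => [|j r [x Px [xi xr]]].
  by have [x Px xi] := coord_surj i 1; exists x.
have [->|ji] := eqVneq j i.
  exists x => //; split=> // j'; rewrite inE => /predU1P[->|/xr//].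
  by rewrite eqxx.
have [y Py [yi yj]] := separate (i1 := i) (i2 := j) ltac:(by rewrite eq_sym).
exists (x * y); first exact: PM.
rewrite !ffunE xi yi mulr1; split=> // j' /predU1P[->|/xr x0 j'i].
  by rewrite !ffunE yj mulr0.
by rewrite !ffunE x0 ?mul0r.
Qed.

End Converse.

(** The form of the Chinese remainder theorem on which everything rests: apart
from intertwiners between coordinates, nothing prevents coordinatewise generators
from generating the product. *)
Lemma generating_powP s :
  generating_pow s <->
    (forall i, generating_mx (fun j => s j i)) /\
    (forall i1 i2 (g : 'M_n), i1 != i2 ->
       (forall j, s j i1 *m g = g *m s j i2) -> g = 0).
Proof.
split=> [gen_s|[gen_s s_nonconj] P subP Ps a].
  split=> [i|i1 i2 g]; [exact: generating_coord | exact: generating_no_intertwiner].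
have [P0 PD PZ PM] := subP.
have -> : a = \sum_i [ffun j => if j == i then a i else 0].
  apply/ffunP => i; rewrite sum_ffunE (bigD1 i) //= ffunE eqxx big1 ?addr0 // => j.
  by rewrite ffunE eq_sym => /negbTE->.
apply: (subalgebra_sum _ subP) => i _.
have [x Px xi] := coord_surj gen_s subP Ps i (a i).
have Pe := coordinate_idempotent gen_s s_nonconj subP Ps i.
suff -> : [ffun j => if j == i then a i else 0] = [ffun j => (j == i)%:R] * x.
  exact: PM.
by apply/ffunP => j; rewrite !ffunE; case: eqP => [->|]; rewrite ?mul1r ?mul0r.
Qed.

End Pow.

(** * Generating powers and orbits of generating tuples *)

(** Schur's lemma: the left kernel of g is stable under the t_j, hence under
all matrices, so it is zero unless g is. *)
Lemma intertwiner_unit (F : fieldType) (n : nat) (I : Type) (t u : I -> 'M[F]_n)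
    (g : 'M_n) :
    @generating F 'M[F]_n *:%R I t -> g != 0 ->
  (forall j, t j *m g = g *m u j) -> g \in unitmx.
Proof.
move=> gen_t /matrix0Pn[r [c g_nz]] tg.
have ker_stable a : (kermx g *m a <= kermx g)%MS.
  apply: (gen_t (fun a => (kermx g *m a <= kermx g)%MS)) => [|j].
    split=> [|x y xg yg|b x xg|x y xg yg].
    - by rewrite mulmx0 sub0mx.
    - by rewrite mulmxDr addmx_sub.
    - by rewrite -scalemxAr scalemx_sub.
    - by rewrite -[x * y]/(x *m y) mulmxA; apply: submx_trans yg; apply: submxMr.
  by apply/sub_kermxP; rewrite -mulmxA tg mulmxA mulmx_ker mul0mx.
rewrite -row_free_unit -kermx_eq0; apply: contraNT g_nz => /matrix0Pn[p [q ker_nz]].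
have /sub_kermxP/matrixP/(_ p c)/eqP := ker_stable (delta_mx q r).
rewrite -mulmxA mxE (bigD1 q) //= big1 ?addr0 => [|i iq]; last first.
  rewrite [X in _ * X]mxE big1 ?mulr0 // => l _.
  by rewrite mxE (negbTE iq) mul0r.
rewrite [X in _ * X]mxE (bigD1 r) //= big1 ?addr0 => [|i ir]; last first.
  by rewrite mxE (negbTE ir) andbF mul0r.
by rewrite [X in _ == X]mxE [delta_mx _ _ _ _]mxE !eqxx mul1r mulf_eq0 (negbTE ker_nz).
Qed.

Section Orbits.
Variables (F : finFieldType) (n m : nat).
Local Notation tup := {ffun 'I_m -> 'M[F]_n.+1}.
Local Notation generating_mx t := (@generating F 'M[F]_n.+1 *:%R 'I_m t).

Definition conj_tuple (t : tup) (g : {'GL_n.+1[F]}) : tup :=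
  [ffun j => (GLval g)^-1 * t j * GLval g].

Lemma conj_tuple1 : conj_tuple^~ 1%g =1 id.
Proof.
by move=> t; apply/ffunP => j; rewrite ffunE GL_1E invr1 mul1r mulr1.
Qed.

Lemma conj_tupleM t : act_morph conj_tuple t.
Proof.
move=> g h; apply/ffunP => j; rewrite !ffunE GL_ME invrM ?GL_unit //.
by rewrite !mulrA.
Qed.

Canonical conj_action := TotalAction conj_tuple1 conj_tupleM.

Definition gen_tuples : {set tup} := [set t : tup | `[< generating_mx t >]].

Definition gen_orbits := orbit conj_action 'GL_n.+1[F] @: gen_tuples.

Lemma conj_tupleP (t u : tup) (g : {'GL_n.+1[F]}) :
  u = conj_tuple t g <-> forall j, t j *m GLval g = GLval g *m u j.
Proof.
split=> [-> j|tu]; first by rewrite ffunE !mulmxA mulmxV ?mul1mx ?GL_unitmx.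
apply/ffunP => j; rewrite ffunE -[RHS]mulmxA tu mulmxA.
by rewrite mulVmx ?mul1mx ?GL_unitmx.
Qed.

(** A choice of k distinct orbits is the same, up to conjugation in each
coordinate, as a generating m-tuple of M_n(F)^k. *)
Lemma admitsP k : admits F n.+1 k m <-> (k <= #|gen_orbits|)%N.
Proof.
split=> [[S /generates_generating/generating_powP[gen_S S_nonconj]]|le_k].
  pose t i : tup := [ffun j => tnth S j i].
  pose orb i := orbit conj_action 'GL_n.+1[F] (t i).
  have orb_inj : injective orb.
    move=> i1 i2 eq_orb; apply/eqP; apply: contraT => i12.
    have : t i2 \in orb i1 by rewrite eq_orb orbit_refl.
    case/orbitP => g _ /esym/conj_tupleP tg.
    have g0 : GLval g = 0.
      by apply: (S_nonconj _ _ _ i12) => j; have := tg j; rewrite !ffunE.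
    by have := GL_det g; rewrite [val g]g0 det0 eqxx.
  rewrite -{1}[k]card_ord -(card_imset _ orb_inj); apply: subset_leq_card.
  apply/fintype.subsetP => _ /imsetP[i _ ->]; apply: imset_f; rewrite inE; apply/asboolP.
  by congr generating: (gen_S i); apply/funext => j; rewrite ffunE.
pose orb (i : 'I_k) := enum_val (widen_ord le_k i).
have orbP i : exists t, t \in gen_tuples /\ orb i = orbit conj_action 'GL_n.+1[F] t.
  by have /imsetP[t tP tE] := enum_valP (widen_ord le_k i); exists t.
pose t i := sval (cid (orbP i)).
have gen_t i : generating_mx (t i).
  by rewrite /t; case: cid => /= u [+ _]; rewrite inE => /asboolP.
have orbE i : orb i = orbit conj_action 'GL_n.+1[F] (t i).
  by rewrite /t; case: cid => /= u [_ ->].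
exists [tuple [ffun i => t i j] | j < m].
apply/generates_generating/generating_powP; split=> [i|i1 i2 g i12 tg].
  by congr generating: (gen_t i); apply/funext => j; rewrite tnth_mktuple ffunE.
have {}tg j : t i1 j *m g = g *m t i2 j.
  by have := tg j; rewrite tnth_mktuple !ffunE.
apply/eqP; apply: contraT => g_nz; case/eqP: i12.
have gU := intertwiner_unit (gen_t i1) g_nz tg.
have /conj_tupleP tE : forall j, t i1 j *m GLval (Sub g gU : {'GL_n.+1[F]}) =
  GLval (Sub g gU : {'GL_n.+1[F]}) *m t i2 j by [].
have /enum_val_inj/(congr1 val)/= : orb i1 = orb i2; last exact: val_inj.
rewrite !orbE; apply/eqP; rewrite tE eq_sym; apply/eqP; apply: orbit_act.
by rewrite inE.
Qed.
End Orbits.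

(** * The size of the orbits *)

Lemma central_scalar (R : comPzRingType) (n : nat) (g : 'M[R]_n.+1) :
  (forall a, a *m g = g *m a) -> g = (g 0 0)%:M.
Proof.
move=> g_central; apply/matrixP => i j.
have /matrixP/(_ 0 j) := g_central (delta_mx 0 i).
rewrite mulmx_delta summxE mxE (bigD1 i) //= big1 ?addr0 => [|l li]; last first.
  by rewrite mxE (negbTE li) andbF mul0r.
rewrite mxE !eqxx mul1r => ->; rewrite (bigD1 0) //= big1 ?addr0 => [|l l0]; last first.
  by rewrite !mxE (eq_sym 0) (negbTE l0) mulr0.
by rewrite !mxE eqxx eq_sym mulr_natr.
Qed.

Lemma commuting_scalar (R : comPzRingType) (n : nat) (I : Type)
    (t : I -> 'M[R]_n.+1) (g : 'M_n.+1) :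
    @generating R 'M[R]_n.+1 *:%R I t -> (forall j, t j *m g = g *m t j) ->
  g = (g 0 0)%:M.
Proof.
move=> gen_t tg; apply: central_scalar.
apply: (gen_t (fun a => a *m g = g *m a)) => //.
split=> [|x y xg yg|c x xg|x y xg yg].
- by rewrite mul0mx mulmx0.
- by rewrite mulmxDl mulmxDr xg yg.
- by rewrite -scalemxAl -scalemxAr xg.
- by rewrite -mulmxA yg mulmxA xg -mulmxA.
Qed.

Section OrbitSize.
Variables (F : finFieldType) (n m : nat).
Local Notation tup := {ffun 'I_m -> 'M[F]_n.+1}.

Lemma stab_gen_tuple (t : tup) : t \in gen_tuples F n m ->
  'C_('GL_n.+1[F])[t | conj_action F n m]%g =
  [set g | is_scalar_mx (GLval g)].
Proof.
rewrite inE => /asboolP gen_t; apply/setP => g; rewrite !inE !sub1set !inE /=.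
apply/eqP/is_scalar_mxP => [/esym/conj_tupleP tg|[c gE]]; last first.
  by apply/esym/conj_tupleP => j; rewrite gE scalar_mxC.
by exists (GLval g 0 0); apply: commuting_scalar gen_t tg.
Qed.

Lemma card_scalar_GL :
  #|[set g : {'GL_n.+1[F]} | is_scalar_mx (GLval g)]| = #|F|.-1.
Proof.
pose f (c : F) : {'GL_n.+1[F]} := insubd (1%g : {'GL_n.+1[F]}) (c%:M : 'M[F]_n.+1).
have fE c : c != 0 -> GLval (f c) = c%:M.
  by move=> c0; rewrite -[LHS]/(val _) insubdK // unitmxE det_scalar unitrX ?unitfE.
rewrite -(cardsC1 (0 : F)) -(card_in_imset (f := f)) => [|b c]; last first.
  rewrite !inE => b0 c0 /(congr1 (@GLval _ _)); rewrite !fE // => /matrixP/(_ 0 0).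
  by rewrite !mxE eqxx.
congr #|pred_of_set _|; apply/setP => g; rewrite inE.
apply/is_scalar_mxP/imsetP => [[c gE]|[c]]; last first.
  by rewrite !inE => c0 ->; exists c; apply: fE.
have c0 : c != 0.
  by apply: contraTneq (GL_det g) => c0; rewrite [val g]gE c0 raddf0 det0 eqxx.
by exists c; [rewrite !inE | apply: val_inj; rewrite [RHS]fE].
Qed.

Lemma gen_tuples_conj (t : tup) g :
  t \in gen_tuples F n m -> conj_tuple t g \in gen_tuples F n m.
Proof.
have gU : (GLval g : 'M[F]_n.+1) \is a GRing.unit := GL_unit g.
rewrite !inE => /asboolP gen_t; apply/asboolP => P [P0 PD PZ PM] Pt a.
have -> : a = (GLval g)^-1 * (GLval g * a * (GLval g)^-1) * GLval g.
  by rewrite !mulrA mulVr ?GL_unit // mul1r -mulrA mulVr ?GL_unit // mulr1.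
apply: (gen_t (fun b => P ((GLval g)^-1 * b * GLval g))) => [|j]; last first.
  by have := Pt j; rewrite ffunE.
split=> [|x y Px Py|c x Px|x y Px Py].
- by rewrite mulr0 mul0r.
- by rewrite mulrDr mulrDl; apply: PD.
- by rewrite -scalerAr -scalerAl; apply: PZ.
- by have := PM _ _ Px Py; rewrite !mulrA mulrK.
Qed.

(** By [stab_gen_tuple] every orbit has #|GL| / (#|F| - 1) elements. *)
Lemma card_gen_tuples :
  (#|gen_tuples F n m| * #|F|.-1 = #|gen_orbits F n m| * #|'GL_n.+1[F]%g|)%N.
Proof.
have actsGL : [acts 'GL_n.+1[F], on gen_tuples F n m | conj_action F n m]%g.
  apply/actsP => g _ t; apply/idP/idP; last exact: gen_tuples_conj.
  by move/(gen_tuples_conj g^-1%g);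
    rewrite -[conj_tuple _ _]/(conj_action F n m _ _) actK.
rewrite -(acts_sum_card_orbit actsGL) big_distrl /= -sum_nat_const.
apply: eq_bigr => _ /imsetP[t tP ->].
rewrite card_orbit -card_scalar_GL -(stab_gen_tuple tP) mulnC Lagrange //.
exact: subsetIl.
Qed.

End OrbitSize.

(** * Generating tuples of 2 x 2 matrices *)

(** The trace form identifies linear functionals on matrices with matrices; a
proper subspace is killed by a nonzero functional. *)
Lemma trace_orthogonal (F : finFieldType) (n : nat) (P : 'M[F]_n -> Prop) (a : 'M[F]_n) :
    P 0 -> (forall x y, P x -> P y -> P (x + y)) ->
    (forall c x, P x -> P (c *: x)) -> ~ P a ->
  exists2 y : 'M_n, y != 0 & forall x, P x -> \tr (y *m x) = 0.
Proof.
move=> P0 PD PZ nPa.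
pose A := [set x : 'M[F]_n | `[< P x >]].
pose M := \matrix_(i < #|A|) mxvec (enum_val i).
have MP x : P x -> (mxvec x <= M)%MS.
  move=> Px; have xA : x \in A by rewrite inE; apply/asboolP.
  by rewrite -(enum_rankK_in xA xA) -(rowK (fun i => mxvec (enum_val i))) row_sub.
have /matrix0Pn[k [l w_nz]] : cokermx M != 0.
  rewrite cokermx_eq0; apply/negP => Mfull; apply: nPa.
  have /submxP[D aD] := submx_full (mxvec a) Mfull.
  rewrite -(mxvecK a) aD mulmx_sum_row linear_sum; apply: (big_ind P) => // i _.
  rewrite linearZ /= rowK mxvecK; apply: PZ.
  by have := enum_valP i; rewrite inE => /asboolP.
pose f (x : 'M[F]_n) := (mxvec x *m cokermx M) 0 l.
exists (\matrix_(i, j) f (delta_mx j i)) => [|x Px].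
  apply: contraNneq w_nz => /matrixP y0.
  case/mxvec_indexP: k => i j; have := y0 j i.
  by rewrite mxE [RHS]mxE /f mxvec_delta -rowE mxE => ->.
have <- : f x = 0.
  by have := MP x Px; rewrite submxE /f => /eqP ->; rewrite mxE.
rewrite /f [x in RHS]matrix_sum_delta linear_sum mulmx_suml summxE.
rewrite /mxtrace (eq_bigr _ (fun i _ => mxE _ _ i i)) exchange_big.
apply: eq_bigr => i _; rewrite linear_sum mulmx_suml summxE.
by apply: eq_bigr => j _; rewrite mxE linearZ -scalemxAl [RHS]mxE mulrC.
Qed.

(** A subalgebra that becomes everything after adjoining 1 is a two-sided ideal.
By simplicity, adjoining 1 to the generators therefore makes no difference, unless
they are all zero. *)
Lemma generating_unital (F : fieldType) (n : nat) (P : 'M[F]_n -> Prop) (s : 'M_n) :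
    @subalgebra F 'M[F]_n *:%R P -> P s -> s != 0 ->
  (forall a : 'M_n, exists c : F, P (a - c%:M)) -> forall a, P a.
Proof.
move=> [P0 PD PZ PM] Ps /matrix0Pn[p [q s_nz]] P1.
have Pl a x : P x -> P (a * x).
  move=> Px; have [c Pac] := P1 a.
  rewrite -(subrK c%:M a) mulrDl; apply: PD; first exact: PM.
  by rewrite -[_%:M * x]/(_ *m x) mul_scalar_mx; apply: PZ.
have Pr a x : P x -> P (x * a).
  move=> Px; have [c Pac] := P1 a.
  rewrite -(subrK c%:M a) mulrDr; apply: PD; first exact: PM.
  by rewrite -[x * _%:M]/(x *m _) mul_mx_scalar; apply: PZ.
move=> a; rewrite -[a]mulr1; apply: (Pl).
rewrite -(mx_simple s_nz); apply: (big_ind P) => // i _.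
by apply/PZ/(Pr (delta_mx q i))/Pl.
Qed.

Definition mx2 (R : pzRingType) (a b c d : R) : 'M[R]_2 :=
  \matrix_(i, j) if i == 0 then if j == 0 then a else b
                 else if j == 0 then c else d.

Lemma mx2P (R : pzRingType) (a : 'M[R]_2) :
  a = mx2 (a 0 0) (a 0 1) (a 1 0) (a 1 1).
Proof.
apply/matrixP => i j; rewrite mxE.
by case: i => -[|[|]] // ?; case: j => -[|[|]] // ? /=; congr (a _ _); apply: val_inj.
Qed.

Lemma mx2M (R : pzRingType) (a b c d a' b' c' d' : R) :
  mx2 a b c d *m mx2 a' b' c' d' =
  mx2 (a * a' + b * c') (a * b' + b * d') (c * a' + d * c') (c * b' + d * d').
Proof.
apply/matrixP => i j; rewrite !mxE !big_ord_recl big_ord0 !mxE addr0 /=.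
by case: (i == 0); case: (j == 0).
Qed.

Lemma mx2Z (R : comPzRingType) (x a b c d : R) :
  x *: mx2 a b c d = mx2 (x * a) (x * b) (x * c) (x * d).
Proof. by apply/matrixP => i j; rewrite !mxE; do 2!case: ifP. Qed.

Lemma mx2_0 (R : pzRingType) : mx2 0 0 0 0 = 0 :> 'M[R]_2.
Proof. by apply/matrixP => i j; rewrite !mxE; do 2!case: ifP. Qed.

Lemma mx2_inj (R : pzRingType) (a b c d a' b' c' d' : R) :
  mx2 a b c d = mx2 a' b' c' d' -> [/\ a = a', b = b', c = c' & d = d'].
Proof.
by move=> /matrixP E; have := (E 0 0, E 0 1, E 1 0, E 1 1); rewrite !mxE /= => -[[[]]].
Qed.

Lemma mxtrace_mx2 (R : pzRingType) (a b c d : R) : \tr (mx2 a b c d) = a + d.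
Proof. by rewrite /mxtrace !big_ord_recl big_ord0 !mxE addr0. Qed.

Section Criterion.
Variables (F : finFieldType) (m : nat).
Local Notation V := 'rV[F]_m.
Local Notation tup := {ffun 'I_m -> 'M[F]_2}.
Implicit Types b c d e : V.

(** The vector e holds the differences of the diagonal entries. *)
Definition tuple_of c e d b : tup :=
  [ffun j => mx2 (d 0 j + e 0 j) (b 0 j) (c 0 j) (d 0 j)].

Definition line c : {set V} := [set x *: c | x : F].

(** For c <> 0, the vectors b for which [tuple_of c e d b] does not generate: for
e outside the line of c, the condition b = x^2 c - x e says that (x, 1) is a
common eigenvector; for e in this line, b in the line means that all the matrices
are polynomials in a single one. *)
Definition excluded c e : {set V} :=
  if e \in line c then line c else [set x ^+ 2 *: c - x *: e | x : F].

Lemma card_line c : c != 0 -> #|line c| = #|F|.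
Proof.
move=> c0; rewrite card_imset // => x y /eqP.
by rewrite -subr_eq0 -scalerBl scaler_eq0 (negbTE c0) orbF subr_eq0 => /eqP.
Qed.

Lemma card_excluded c e : c != 0 -> #|excluded c e| = #|F|.
Proof.
rewrite /excluded; move=> c0; case: ifPn => [_|eNc]; first exact: card_line.
rewrite card_imset // => x y /eqP; apply: contraTeq => xy.
rewrite -subr_eq0.
have -> : x ^+ 2 *: c - x *: e - (y ^+ 2 *: c - y *: e) =
   (x - y) *: ((x + y) *: c - e).
  by apply/rowP => j; rewrite !mxE; ring.
rewrite scaler_eq0 subr_eq0 (negbTE xy) subr_eq0 /=.
by apply: contraNneq eNc => <-; apply: imset_f.
Qed.

(** For the condition to be necessary, see [no_eigenvector] in the proof and
[commuting_scalar]. Conversely, suppose that the subalgebra P1 spanned by the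
tuple and 1 is proper, and take y <> 0 orthogonal to P1 for the trace form.
Orthogonality to 1 makes y traceless, and orthogonality to the tuple is a linear
relation between e, c and b whose coefficients are the entries of y. When c <> 0
and b is not excluded, e, c and b span a space of dimension at least 2, so this
relation is unique up to a scalar. As t_j y is again orthogonal to P1, it is a
multiple of y, and a nonzero column of y is a common eigenvector; this forces
c = 0 or b = x^2 c - x e. *)
Lemma gen_tuple_of c e d b :
  (tuple_of c e d b \in gen_tuples F 1 m) =
  (c != 0) && (b \notin excluded c e).
Proof.
rewrite inE; apply/asboolP/andP => [gen_t|[c0 bN]].
  (* A common eigenvector gives an intertwiner of rank 1 with a tuple of scalar
     matrices. *)
  have no_eigenvector x y (l : 'I_m -> F) :
      (forall j, tuple_of c e d b j *m mx2 x 0 y 0 = mx2 x 0 y 0 *m (l j)%:M) ->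
    x = 0 /\ y = 0.
    move=> xyl; suff /eqP : mx2 x 0 y 0 == 0 by rewrite -mx2_0 => /mx2_inj[].
    apply: contraT => /(intertwiner_unit gen_t)/(_ xyl) gU.
    have /mx2_inj[_ _ _ /eqP] : mx2 0 0 0 1 = mx2 0 0 0 0 :> 'M[F]_2.
      by rewrite -[LHS](mulKmx gU) mx2M !(mulr0, mul0r, addr0) mx2_0 mulmx0.
    by rewrite oner_eq0.
  split.
    apply/eqP => c0.
    have [j|/eqP] := @no_eigenvector 1 0 (fun j => d 0 j + e 0 j);
      last by rewrite oner_eq0.
    by rewrite ffunE c0 mul_mx_scalar mx2M mx2Z !mxE !(mulr0, mul0r, addr0, mulr1).
  rewrite /excluded; case: ifPn => [/imsetP[s _ eE]|eN]; apply/imsetP => -[x _ bE].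
    have /matrixP/(_ 1 0)/eqP : mx2 s x 1 0 = (mx2 s x 1 0 0 0)%:M.
      apply: (commuting_scalar gen_t) => j.
      rewrite ffunE eE bE !mx2M !mxE; congr mx2; ring.
    by rewrite !mxE oner_eq0.
  have [j|_ /eqP] := @no_eigenvector x 1 (fun j => c 0 j * x + d 0 j);
    last by rewrite oner_eq0.
  rewrite ffunE bE mul_mx_scalar mx2M mx2Z !mxE; congr mx2; ring.
move=> P subP Pt; have [P0 PD PZ PM] := subP.
have /rV0Pn[j0 cj0] := c0.
apply: (generating_unital subP (Pt j0)) => [|a].
  by apply: contraNneq cj0 => /matrixP/(_ 1 0); rewrite !ffunE !mxE /= => ->.
(* The span of P and 1. *)
pose P1 a := exists k, P (a - k%:M).
apply: contrapT => nP1a.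
have P1D x y : P1 x -> P1 y -> P1 (x + y).
  by move=> [k Px] [l Py]; exists (k + l); rewrite raddfD opprD addrACA; apply: PD.
have P1Z k x : P1 x -> P1 (k *: x).
  by move=> [l Px]; exists (k * l); rewrite -scale_scalar_mx -scalerBr; apply: PZ.
have P1_sub x : P x -> P1 x by exists 0; rewrite raddf0 subr0.
have P1_1 : P1 1%:M by exists 1; rewrite subrr.
have P1M x j : P1 x -> P1 (x *m tuple_of c e d b j).
  move=> [k Px]; rewrite -(subrK k%:M x) mulmxDl mul_scalar_mx.
  by apply: P1D; [apply/P1_sub/PM | apply/P1Z/P1_sub].
have [y y0 yP1] := trace_orthogonal (P1_sub _ P0) P1D P1Z nP1a.
pose orth (u : 'M[F]_2) := forall x, P1 x -> \tr (u *m x) = 0.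
have orth_rel al be ga de : orth (mx2 al be ga de) ->
    de = - al /\ al *: e + be *: c + ga *: b = 0.
  move=> uP1; have := uP1 _ P1_1; rewrite mulmx1 mxtrace_mx2 addrC => /eqP.
  rewrite addr_eq0 => /eqP deE; split=> //; apply/rowP => j.
  have := uP1 _ (P1_sub _ (Pt j)); rewrite ffunE mx2M mxtrace_mx2 deE !mxE => <-.
  ring.
have orth_t j : orth (tuple_of c e d b j *m y).
  by move=> x P1x; rewrite -mulmxA mxtrace_mulC -mulmxA yP1 //; apply: P1M.
(* Both y and t_j y yield relations; they are compared in the two cases of the
   definition of [excluded]. *)
have [al [be [ga yE]]] : exists al be ga, y = mx2 al be ga (- al).
  move: (yP1); rewrite (mx2P y) => /orth_rel[-> _].
  by exists (y 0 0), (y 0 1), (y 1 0).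
have [_ y_rel] := orth_rel al be ga (- al) ltac:(by rewrite -yE).
have ty_rel j : ((d 0 j + e 0 j) * al + b 0 j * ga) *: e +
    ((d 0 j + e 0 j) * be + b 0 j * - al) *: c + (c 0 j * al + d 0 j * ga) *: b = 0.
  by have := orth_t j; rewrite yE ffunE mx2M => /orth_rel[].
(* If e = s c, the coefficient of b vanishes in every relation, and the column
   (1, 0) of y is an eigenvector. *)
case/negP: bN; rewrite /excluded; case: ifPn => [/imsetP[s _ eE]|eN].
  apply: contraT => bN.
  have ga0 u v w : u *: e + v *: c + w *: b = 0 -> w = 0.
    move=> rel; apply/eqP; apply: contraNT bN => w0; apply/imsetP.
    exists (- (u * s + v) / w) => //; apply: (scalerI w0).
    rewrite scalerA mulrCA divff // mulr1 scaleNr; apply/eqP.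
    by rewrite -addr_eq0 addrC scalerDl -scalerA -eE rel.
  have gaE := ga0 _ _ _ y_rel.
  have al0 : al != 0.
    apply: contraNneq y0 => alE; move/eqP: y_rel.
    rewrite gaE alE !scale0r add0r addr0 scaler_eq0 (negbTE c0) orbF => /eqP beE.
    by rewrite yE alE beE gaE oppr0 mx2_0.
  have /eqP := ga0 _ _ _ (ty_rel j0).
  by rewrite gaE mulr0 addr0 mulf_eq0 (negbTE cj0) (negbTE al0).
(* If e is not a multiple of c, the coefficient ga of b is nonzero in the relation
   of y, and the eigenvector is (al / ga, 1). *)
have al0 u v : u *: e + v *: c = 0 -> u = 0.
  move=> rel; apply/eqP; apply: contraNT eN => u0; apply/imsetP.
  exists (- v / u) => //; apply: (scalerI u0).
  rewrite scalerA mulrCA divff // mulr1 scaleNr; apply/eqP.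
  by rewrite -addr_eq0 rel.
have gaN0 : ga != 0.
  apply: contraNneq y0 => gaE; move: y_rel; rewrite gaE scale0r addr0 => y_rel.
  have alE := al0 _ _ y_rel; move/eqP: y_rel.
  rewrite alE scale0r add0r scaler_eq0 (negbTE c0) orbF => /eqP beE.
  by rewrite yE alE beE gaE oppr0 mx2_0.
apply/imsetP; exists (al / ga) => //; apply/rowP => j.
pose k := (c 0 j * al + d 0 j * ga) / ga.
have kga : k * ga = c 0 j * al + d 0 j * ga by rewrite divfK.
have := al0 ((d 0 j + e 0 j) * al + b 0 j * ga - k * al)
  ((d 0 j + e 0 j) * be + b 0 j * - al - k * be).
have -> : ((d 0 j + e 0 j) * al + b 0 j * ga - k * al) *: e +
  ((d 0 j + e 0 j) * be + b 0 j * - al - k * be) *: c = 0.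
  apply/rowP => i; have /rowP/(_ i) := ty_rel j; have /rowP/(_ i) := y_rel.
  rewrite !mxE -kga => yi tyi; rewrite -[RHS](subrr 0) -{1}tyi -(mulr0 k) -yi; ring.
move=> /(_ erefl) bE; apply: (mulIf gaN0); rewrite !mxE.
move/eqP: bE; rewrite subr_eq0 /k => /eqP bE.
have -> : b 0 j * ga = (c 0 j * al + d 0 j * ga) / ga * al - (d 0 j + e 0 j) * al.
  by rewrite -bE; ring.
by field.
Qed.

Lemma card_gen_tuples2 :
  #|gen_tuples F 1 m| =
    (((#|F| ^ m).-1 * #|F| ^ m * #|F| ^ m) * (#|F| ^ m - #|F|))%N.
Proof.
have cardV : #|{: V}| = (#|F| ^ m)%N by rewrite card_mx mul1n.
pose f (v : V * V * V * V) := tuple_of v.1.1.1 v.1.1.2 v.1.2 v.2.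
pose params := [set v : V * V * V * V |
  (v.1.1.1 != 0) && (v.2 \notin excluded v.1.1.1 v.1.1.2)].
have f_inj : injective f.
  move=> [[[c e] d] b] [[[c' e'] d'] b'] /ffunP fE.
  have {}fE j := mx2_inj (etrans (esym (ffunE _ j)) (etrans (fE j) (ffunE _ j))).
  have dE : d = d' by apply/rowP => j; have [_ _ _] := fE j.
  congr (_, _, _, _) => //; apply/rowP => j; have [/=] := fE j => //.
  by rewrite dE => /addrI.
have -> : gen_tuples F 1 m = f @: params.
  apply/setP => t; apply/idP/imsetP => [gen_t|[v + ->]]; last first.
    by rewrite inE gen_tuple_of.
  pose v := (\row_j t j 1 0, \row_j (t j 0 0 - t j 1 1), \row_j t j 1 1, \row_j t j 0 1).
  have tE : t = f v.
    by apply/ffunP => j; rewrite ffunE /= !mxE addrC subrK -mx2P.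
  by exists v => //; move: gen_t; rewrite tE gen_tuple_of inE.
rewrite (card_imset _ f_inj) -sum1dep_card.
rewrite -(pair_big_dep (fun p : V * V * V => p.1.1 != 0)
  (fun p b => b \notin excluded p.1.1 p.1.2) (fun _ _ => 1%N)) /=.
rewrite (eq_bigr (fun _ => (#|F| ^ m - #|F|)%N)) => [|[[c e] d] /= c0]; last first.
  by rewrite sum1_card -cardV -(card_excluded e c0) -(cardC (mem (excluded c e))) addKn.
rewrite sum_nat_cond_const; congr (_ * _)%N.
rewrite (_ : [set i | _] = setX (setX [set~ 0] [set: V]) [set: V]).
  by rewrite !cardsX cardsC1 !cardsT cardV.
by apply/setP => -[[c e] d]; rewrite !inE !andbT.
Qed.

End Criterion.

(** * The value of gen for 2 x 2 matrices *)

Lemma gen_gen_orbits (F : finFieldType) (n m : nat) :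
  gen m n.+1 F = (#|gen_orbits F n m|%:R)%:E.
Proof.
apply: gen_spec_uniq (gen_specP _ _ _) _; left; exists #|gen_orbits F n m|.
split=> // [|m' m'P]; first exact/admitsP.
by rewrite ltnNge; apply/negP => /admits_leq/(_ m'P)/admitsP; rewrite ltnn.
Qed.

(** The value of gen for 2 x 2 matrices over a field with q elements, as a
function of q and Q = q^m. *)
Definition gen2_value (R : fieldType) (q Q : R) :=
  Q ^+ 2 * (Q - 1) * (Q - q) / (q * (q ^+ 2 - 1)).

Lemma gen2E (F : finFieldType) (m : nat) : (0 < m)%N ->
  gen m 2 F = (gen2_value #|F|%:R (#|F|%:R ^+ m))%:E.
Proof.
move=> m_gt0; rewrite gen_gen_orbits /gen2_value; congr _%:E.
have := card_gen_tuples F 1 m; rewrite card_gen_tuples2 card_GL_2.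
have q_gt1 := card_finNzRing_gt1 F.
set q := #|F| in q_gt1 *; set N := #|_|.
have leqQ : (q <= q ^ m)%N by rewrite -{1}(expn1 q) leq_exp2l.
have Q_gt0 : (0 < q ^ m)%N by apply: leq_trans leqQ; apply: ltnW.
move/(congr1 (fun k => k%:R : rat)).
rewrite !natrM !natrX natrB // -!subn1 !natrB ?natrX // 1?ltnW // -[q.+1]addn1 natrD.
have q1 : (1 : rat) < q%:R by rewrite ltr1n.
move: (q%:R ^+ m : rat) (q%:R : rat) q1 (N%:R : rat) => Q z z1 M E.
have z0 : z != 0 by rewrite gt_eqF // (lt_trans ltr01).
have zm0 : z - 1 != 0 by rewrite subr_eq0 gt_eqF.
have zp0 : z + 1 != 0 by rewrite gt_eqF // addr_gt0 // (lt_trans ltr01).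
have z20 : z ^+ 2 - 1 != 0 by rewrite -[1 in X in X != _](expr1n _ 2) subr_sqr mulf_neq0.
apply: (mulIf (mulf_neq0 z0 z20)); rewrite divfK ?mulf_neq0 //.
apply: (mulIf zm0).
transitivity (M * (z * (z - 1) ^+ 2 * (z + 1))); first by ring.
by rewrite -E; ring.
Qed.

Lemma gen2_value_closed (R : realFieldType) (q : R) (m : nat) : 1 < q -> (0 < m)%N ->
  gen2_value q (q ^+ m) =
    (q ^+ (4 * m - 1) + q ^+ (2 * m) - q ^+ (3 * m) - q ^+ (3 * m - 1)) / (q ^+ 2 - 1).
Proof.
case: m => // m q1 _; have q0 : q != 0 by rewrite gt_eqF // (lt_trans ltr01).
have q20 : q ^+ 2 - 1 != 0 by rewrite subr_eq0 gt_eqF // exprn_egt1.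
have pred_exp k : (0 < k)%N -> q ^+ (k * m.+1 - 1) = q ^+ (k * m.+1) / q.
  by case: k => // k _; rewrite mulSn addSn subn1 exprS mulrC mulKf.
rewrite /gen2_value !pred_exp // !(mulnC _ m.+1) !exprM.
move: (q ^+ m.+1) => Q; field.
by rewrite q20.
Qed.

Lemma gen2_value_ltQ (R : realFieldType) (q Q Q' : R) : 1 < q -> q <= Q -> Q < Q' ->
  gen2_value q Q < gen2_value q Q'.
Proof.
move=> q1 qQ QQ'; have q0 : 0 < q by apply: lt_trans q1.
rewrite /gen2_value ltr_pM2r ?invr_gt0 ?mulr_gt0 ?subr_gt0 ?exprn_egt1 //.
have Q0 : 0 < Q by apply: lt_le_trans qQ.
have Q1 : 1 < Q by apply: lt_le_trans qQ.
apply: ltr_pM; rewrite ?mulr_ge0 ?exprn_ge0 ?subr_ge0 ?(ltW Q0) ?(ltW Q1) ?ltrD2r //.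
apply: ltr_pM; rewrite ?exprn_ge0 ?subr_ge0 ?(ltW Q0) ?(ltW Q1) ?ltrD2r //.
by rewrite ltrXn2r // ltW.
Qed.

(** By the geometric series,
  gen2_value q (q^m) =
    q^(2m-1) (1 + q + ... + q^(m-1)) (q^(m-1) - 1) (1 - 1 / (q + 1)),
where every factor is positive and strictly increasing in q. *)
Lemma gen2_value_ltq (R : realFieldType) (q q' : R) (m : nat) :
    1 < q -> q < q' -> (1 < m)%N ->
  gen2_value q (q ^+ m) < gen2_value q' (q' ^+ m).
Proof.
case: m => [|[|m]] // q1 qq' _.
have gen2_prod (x : R) : 1 < x -> gen2_value x (x ^+ m.+2) =
    x ^+ (m.+1 + m.+2) * (\sum_(i < m.+2) x ^+ i) * (x ^+ m.+1 - 1) * (1 - (x + 1)^-1).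
  move=> x1; have x0 : 0 < x by apply: lt_trans x1.
  have xN0 : x != 0 by rewrite gt_eqF.
  have x20 : x ^+ 2 - 1 != 0 by rewrite subr_eq0 gt_eqF // exprn_egt1.
  have xp0 : x + 1 != 0 by rewrite gt_eqF // addr_gt0.
  rewrite exprD; have := subrX1 x m.+2; rewrite exprS.
  move: (x ^+ m.+1) (\sum_(_ < _) _) => Q S E.
  by rewrite /gen2_value E; field; rewrite x20 xp0 xN0.
have q'1 : 1 < q' by apply: lt_trans qq'.
rewrite !gen2_prod //.
have q0 : 0 < q by apply: lt_trans q1.
have S0 : 0 <= \sum_(i < m.+2) q ^+ i by apply: sumr_ge0 => i _; rewrite exprn_ge0 // ltW.
have qm1 : 0 < q ^+ m.+1 - 1 by rewrite subr_gt0 exprn_egt1.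
apply: ltr_pM; rewrite ?mulr_ge0 ?exprn_ge0 ?(ltW q0) ?(ltW qm1) //.
- by rewrite subr_ge0 invf_le1 ?addr_gt0 // lerDr ltW.
- apply: ltr_pM; rewrite ?mulr_ge0 ?exprn_ge0 ?(ltW q0) ?(ltW qm1) //.
    apply: ltr_pM; rewrite ?exprn_ge0 ?(ltW q0) //.
      by rewrite ltrXn2r // ltW.
    rewrite !big_ord_recl !expr0 ltrD2l ltr_leD //.
    by apply: ler_sum => i _; rewrite lerXn2r // ?nnegrE ?ltW // (lt_trans q0).
  by rewrite ltrD2r ltrXn2r // ltW.
by rewrite ltrD2l ltrN2 ltf_pV2 ?posrE ?addr_gt0 ?ltrD2r // (lt_trans q0).
Qed.

(** * The generating series *)

Section Series.
Variable K : fieldType.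
Implicit Types f u v : nat -> K.

Lemma fps_mul_injr f u v : f 0%N != 0 -> fps_mul u f =1 fps_mul v f -> u =1 v.
Proof.
move=> f0 uv; elim/ltn_ind => n IHn; apply: (mulIf f0).
have := uv n; rewrite /fps_mul !big_ord_recr /= !subnn.
have -> : \sum_(i < n) u i * f (n - i)%N = \sum_(i < n) v i * f (n - i)%N.
  by apply: eq_bigr => i _; rewrite IHn.
exact: addrI.
Qed.

(** The inverse of a series is characterized by its product with that series, so
a closed form for it has only to be multiplied back. *)
Lemma fps_div_polyC c f u : f 0%N != 0 ->
    (forall n, fps_mul u f n = (n == 0)%:R) ->
  fps_div (fps_poly c%:P) f =1 (fun n => c * u n).
Proof.
move=> f0 uf n; rewrite /fps_div /fps_mul big_ord_recl big1 => [|i _].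
  rewrite /fps_poly coefC addr0 subn0; congr (_ * _).
  by apply: (fps_mul_injr f0) => k; rewrite fps_mulV // uf.
by rewrite /fps_poly coefC mul0r.
Qed.

Lemma fps_mul_rev u f n : fps_mul u f n = \sum_(i < n.+1) u (n - i)%N * f i.
Proof.
rewrite /fps_mul (reindex_inj rev_ord_inj) /=; apply: eq_bigr => i _.
by rewrite subSS subKn // -ltnS.
Qed.

Lemma coef_cubic (a b c : K) i :
  ((1 - a *: 'X) * (1 - b *: 'X) * (1 - c *: 'X))`_i =
    [:: 1; - (a + b + c); a * b + a * c + b * c; - (a * b * c)]`_i.
Proof.
have -> : (1 - a *: 'X) * (1 - b *: 'X) * (1 - c *: 'X) =
  1 - (a + b + c)%:P * 'X + (a * b + a * c + b * c)%:P * 'X^2 - (a * b * c)%:P * 'X^3.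
  by rewrite -!mul_polyC !(rmorphD, rmorphM) /=; ring.
rewrite !coefE; case: i => [|[|[|[|i]]]] /=; rewrite ?nth_nil; ring.
Qed.

Lemma fps_mul_cubic (a b c : K) u :
    u 0%N = 1 -> u 1%N = a + b + c ->
    u 2%N = (a + b + c) * u 1%N - (a * b + a * c + b * c) ->
    (forall n, u n.+3 = (a + b + c) * u n.+2 - (a * b + a * c + b * c) * u n.+1
                        + a * b * c * u n) ->
  forall n, fps_mul u (fps_poly ((1 - a *: 'X) * (1 - b *: 'X) * (1 - c *: 'X))) n =
    (n == 0)%:R.
Proof.
move=> u0 u1 u2 u3 n; rewrite fps_mul_rev.
under eq_bigr do rewrite /fps_poly coef_cubic.
case: n => [|[|[|n]]].
- rewrite big_ord_recl big_ord0 /= u0; ring.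
- rewrite !big_ord_recl big_ord0 /= u0 u1; ring.
- rewrite !big_ord_recl big_ord0 /= u2 u0 u1; ring.
rewrite 4!big_ord_recl big1 /= => [|i _]; last by rewrite nth_nil mulr0.
by rewrite /bump /= !addn0 !add1n !subSS !subn0 u3; ring.
Qed.
End Series.

Lemma gen2_value_square (R : fieldType) (q : R) :
  q != 0 -> q ^+ 2 - 1 != 0 -> gen2_value q (q ^+ 2) = q ^+ 4 * (q - 1).
Proof.
by move=> q0 q20; rewrite /gen2_value; field; rewrite q0 q20.
Qed.

Lemma gen2_value_series (R : realFieldType) (q : R) : 1 < q ->
  (fun k => gen2_value q (q ^+ k.+2)) =1
    fps_div (fps_poly (gen2_value q (q ^+ 2))%:P)
      (fps_poly ((1 - (q ^+ 2) *: 'X) * (1 - (q ^+ 3) *: 'X) * (1 - (q ^+ 4) *: 'X))).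
Proof.
move=> q1.
have q0 : q != 0 by rewrite gt_eqF // (lt_trans ltr01).
have qm0 : q - 1 != 0 by rewrite subr_eq0 gt_eqF.
have q20 : q ^+ 2 - 1 != 0 by rewrite subr_eq0 gt_eqF // exprn_egt1.
(* The expected coefficients of the inverse of the denominator. *)
pose u k := q ^+ k ^+ 2 * (q ^+ k.+2 - 1) * (q ^+ k.+1 - 1) / ((q ^+ 2 - 1) * (q - 1)).
move=> k; rewrite (@fps_div_polyC _ _ _ u).
- rewrite gen2_value_square // /u /gen2_value 3!exprS.
  by move: (q ^+ k) => Q; field; rewrite q0 q20 qm0.
- by rewrite /fps_poly coef_cubic oner_neq0.
by apply: fps_mul_cubic => [|||n]; rewrite /u ?exprS ?expr0; field; rewrite qm0 q20.
Qed.

Theorem theorem3p5 :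
  [/\ forall (m q : nat) (F : finFieldType), (2 <= m)%N -> #|F| = q ->
        gen m 2 F = (((q%:R ^+ (4 * m - 1) + q%:R ^+ (2 * m)
                       - q%:R ^+ (3 * m) - q%:R ^+ (3 * m - 1))
                      / (q%:R ^+ 2 - 1))%:E)%R,
      forall (m m' : nat) (F : finFieldType), (2 <= m)%N -> (m < m')%N ->
        (gen m 2 F < gen m' 2 F)%E,
      forall (m : nat) (F F' : finFieldType), (2 <= m)%N -> (#|F| < #|F'|)%N ->
        (gen m 2 F < gen m 2 F')%E,
      forall (q : nat) (F : finFieldType), #|F| = q ->
        (fun k => fine (gen k.+2 2 F)) =1
        fps_div (fps_poly (fine (gen 2 2 F))%:P)
          (fps_poly ((1 - (q%:R ^+ 2) *: 'X) * (1 - (q%:R ^+ 3) *: 'X)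
                     * (1 - (q%:R ^+ 4) *: 'X))) &
      forall (q : nat) (F : finFieldType), #|F| = q ->
        gen 2 2 F = (q%:R ^+ 4 * (q%:R - 1))%:E].
Proof.
have card1 (F : finFieldType) : 1 < #|F|%:R :> rat by rewrite ltr1n card_finNzRing_gt1.
have formula m (F : finFieldType) : (2 <= m)%N ->
    gen m 2 F = (gen2_value #|F|%:R (#|F|%:R ^+ m))%:E.
  by move=> m2; rewrite gen2E // ltnW.
split.
- by move=> m q F m2 <-; rewrite formula // gen2_value_closed // ltnW.
- move=> m m' F m2 mm'; rewrite !formula ?(leq_trans m2 (ltnW mm')) // lte_fin.
  rewrite gen2_value_ltQ ?ltr_eXn2l //.
  by rewrite -[leLHS]expr1 ler_eXn2l // ltnW.
- by move=> m F F' m2 FF'; rewrite !formula // lte_fin gen2_value_ltq ?ltr_nat.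
- move=> q F <- k; rewrite !formula //=.
  exact: gen2_value_series.
move=> q F <-; rewrite formula // gen2_value_square //.
  by rewrite gt_eqF // (lt_trans ltr01).
by rewrite subr_eq0 gt_eqF // exprn_egt1.
Qed.
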